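(* There is an absolute constant $c>0$ such that for every $A\ge 1$ there exist a weight $w$ on $[0,1]$ with $[w]_{2,\mathrm{cl}}=A$, a non-homogeneous dyadic filtration $\mathcal D$ of $[0,1]$, and a function $f\in L^2(w)$ such that $$\|f\|_{L^2(w)}\ge c\,A\,\|Sf\|_{L^2(w)}=c\,[w]_{2,\mathrm{cl}}\,\|Sf\|_{L^2(w)}.$$
   Context: $[0,1]$ carries Lebesgue measure, $|I|$ denotes length and $\langle f\rangle_I=|I|^{-1}\int_I f$. A non-homogeneous dyadic filtration of $[0,1]$ is an atomic filtration $\mathcal D=\bigcup_{n\ge0}\mathcal D_n$, $\mathcal D_0=\{[0,1]\}$, where each $\mathcal D_n$ is a finite partition of $[0,1]$ into intervals of positive length and each interval $I\in\mathcal D_n$ is split into exactly two subintervals (its children $\mathrm{ch}(I)$, belonging to $\mathcal D_{n+1}$) of possibly unequal lengths. Martingale differences: $\Delta_I f=\sum_{I'\in\mathrm{ch}(I)}\langle f\rangle_{I'}\mathbf 1_{I'}-\langle f\rangle_I\mathbf 1_I$; square function $Sf=\big(\sum_{I\in\mathcal D}(\Delta_If)^2\big)^{1/2}$. A weight is an integrable function $w>0$ a.e.; $\|f\|_{L^2(w)}^2=\int_0^1|f|^2w$. Classical $A_2$ characteristic: $[w]_{2,\mathrm{cl}}=\sup_{I\subseteq[0,1]}\langle w\rangle_I\langle w^{-1}\rangle_I$, the supremum over all subintervals $I$ of $[0,1]$. *)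

(* Defs.v *)
From HB Require Import structures.
From mathcomp Require Import all_boot all_order all_algebra.
From mathcomp Require Import all_classical all_reals all_analysis.
Set Implicit Arguments. Unset Strict Implicit. Unset Printing Implicit Defensive.
Import Order.TTheory GRing.Theory Num.Theory.
Local Open Scope classical_set_scope.
Local Open Scope ring_scope.

Section Defs.
Variable R : realType.
Local Notation leb := (@lebesgue_measure R).

Definition unit_iv : set R := [set x | 0 <= x <= 1].

(* the (half-open) interval with endpoints p.1 < p.2; endpoints are
   immaterial for Lebesgue measure *)
Definition iv_set (p : R * R) : set R := [set x | p.1 <= x < p.2].

Definition avg (f : R -> R) (p : R * R) : R :=
  (p.2 - p.1)^-1 * Rintegral leb (iv_set p) f.

Definition is_weight (w : R -> R) : Prop :=
  (forall x, unit_iv x -> 0 < w x) /\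
  measurable_fun unit_iv w /\
  leb.-integrable unit_iv (EFin \o w).

Definition civ (a b : R) : set R := [set x | a <= x <= b].
Definition eavg (g : R -> R) (a b : R) : \bar R :=
  (((b - a)^-1)%:E * (\int[leb]_(x in civ a b) (g x)%:E))%E.

Definition A2cl (w : R -> R) : \bar R :=
  ereal_sup [set r : \bar R | exists a b : R,
     [/\ 0 <= a, a < b, b <= 1 & r = (eavg w a b * eavg (fun x => ((w x)^-1)%R) a b)%E]].

(* A non-homogeneous dyadic filtration is encoded by the splitting ratios
   t s in (0,1) attached to each node s (a finite binary word, read from the
   root): the interval of node s is split into its left child of length
   t s * |I| and its right child. *)
Fixpoint node_go (t : seq bool -> R) (pre : seq bool) (p : R * R) (s : seq bool)
  : R * R :=
  match s with
  | [::] => p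
  | b :: s' =>
      let m := p.1 + t pre * (p.2 - p.1) in
      node_go t (rcons pre b) (if b then (m, p.2) else (p.1, m)) s'
  end.

Definition node_iv (t : seq bool -> R) (s : seq bool) : R * R :=
  node_go t [::] (0, 1) s.

Fixpoint nodes (n : nat) : seq (seq bool) :=
  match n with
  | 0%N => [:: [::]]
  | n'.+1 => [seq rcons s b | s <- nodes n', b <- [:: false; true]]
  end.

(* each interval split into two subintervals of positive length, and the
   filtration generates (mesh of D_n tends to 0) *)
Definition is_filtration (t : seq bool -> R) : Prop :=
  (forall s, 0 < t s < 1) /\
  (forall eps : R, 0 < eps -> exists N : nat, forall n, (N <= n)%N ->
     forall s, s \in nodes n -> (node_iv t s).2 - (node_iv t s).1 < eps).

Definition Delta (t : seq bool -> R) (f : R -> R) (s : seq bool) (x : R) : R :=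
  avg f (node_iv t (rcons s false)) * \1_(iv_set (node_iv t (rcons s false))) x
  + avg f (node_iv t (rcons s true)) * \1_(iv_set (node_iv t (rcons s true))) x
  - avg f (node_iv t s) * \1_(iv_set (node_iv t s)) x.

Definition Ssq (t : seq bool -> R) (f : R -> R) (x : R) : \bar R :=
  (\sum_(0 <= n <oo) (\sum_(s <- nodes n) (Delta t f s x) ^+ 2)%:E)%E.

(* ||g||_{L^2(w)}^2 for g given pointwise by its square (extended real) *)
Definition L2w_sq (w : R -> R) (g2 : R -> \bar R) : \bar R :=
  (\int[leb]_(x in unit_iv) (g2 x * (w x)%:E))%E.

End Defs.

(* Main.v *)
Require Import Defs.
From HB Require Import structures.
From mathcomp Require Import all_boot all_order all_algebra.
From mathcomp Require Import all_classical all_reals all_analysis.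
From mathcomp Require Import measurable_realfun ring lra.
Import Order.TTheory GRing.Theory Num.Theory numFieldNormedType.Exports.
Local Open Scope classical_set_scope.
Local Open Scope ring_scope.

(** Take the power weight [w x = x ^ (- al)] with [1 / (1 - al ^ 2) = A]; its
    [A_2] average over [[a, b]] is largest for [a = 0], because
    [s ^ al + s ^ (- al) >= 2].  With [de = 1 - al] and [q = 1 - de / 4], cut a
    piece of relative length [1 - q] off the right end of [[0, q ^ k]] at each
    step, and let [f = k - K] on the piece [[q ^ (k+1), q ^ k)], where
    [K = q / (1 - q)].  Then [f] has mean [k] on [[0, q ^ k)], so each cut
    raises [f] by only [1] on the large part, and [(S f) ^ 2 = k + K ^ 2] on the
    [k]-th piece, while [f ^ 2 = (k - K) ^ 2] there.  The [w]-mass of the [k]-th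
    piece is geometric in [k], with mean [M] comparable to [K / de], i.e. to
    [A K]; hence [||f||^2] is at least of order [M ^ 2 = (A K) ^ 2], whereas
    [||S f||^2] is of order [M + K ^ 2 <= 2 K ^ 2]. *)


(** * Geometric decomposition of an interval and telescoping integrals *)

Section Pieces.
Context {R : realType}.
Local Notation leb := (@lebesgue_measure R).
Implicit Types (q b p z t : R) (k n : nat).

(** Factor [1 - t ^+ n] as [1 - t] times the sum of the [t ^+ i], [i < n]: each of these [n] terms
    is at least [t ^+ n]. *)
Lemma mulrn_expr_bound t n : 0 <= t -> t < 1 ->
  n%:R * t ^+ n * (1 - t) <= 1 - t ^+ n.
Proof.
move=> t0 t1; elim: n => [|n ih]; first by rewrite mul0r mul0r expr0 subrr.
have h1 : t ^+ n <= 1 by apply: exprn_ile1 => //; apply: ltW.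
have h0 : 0 <= t ^+ n by apply: exprn_ge0.
rewrite exprS -natr1.
set x := t ^+ n in ih h1 h0 *; set m := n%:R in ih *.
have ht := ler_wpM2l t0 ih.
have tx : t * x <= 1 by rewrite mulr_ile1// ltW.
have : 0 <= (1 - t) * (1 - t * x) by rewrite mulr_ge0 ?subr_ge0// ltW.
lra.
Qed.

Lemma quadratic_geometric_cvg0 (x y z t : R) : 0 < t -> t < 1 ->
  (fun k : nat => (x + y * k%:R + z * k%:R ^+ 2) * t ^+ k) @ \oo --> (0 : R).
Proof.
move=> t0 t1.
(* With [s] the cube root of [t], two of the three factors [s ^+ k] absorb the growth of [k ^ 2],
   because [k * s ^+ k] stays below [1 / (1 - s)]; the third one tends to 0. *)
pose s := t `^ (3^-1).
have s0 : 0 < s by apply: powR_gt0.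
have s3 : s ^+ 3 = t.
  by rewrite /s -powR_mulrn ?powR_ge0// -powRrM mulVf// powRr1 ?ltW.
have s1 : s < 1.
  rewrite ltNge; apply/negP => s1; have : 1 <= s ^+ 3 by apply: exprn_ege1.
  by rewrite s3 leNgt t1.
pose C := `|x| + `|y| / (1 - s) + `|z| / (1 - s) ^+ 2.
have cg : (fun k => C * s ^+ k) @ \oo --> (0 : R).
  by apply: cvg_geometric; rewrite ger0_norm ?ltW.
have bound k : `|(x + y * k%:R + z * k%:R ^+ 2) * t ^+ k| <= C * s ^+ k.
  have e0 : 0 < s ^+ k by apply: exprn_gt0.
  have e1 : s ^+ k <= 1 by apply: exprn_ile1 => //; apply: ltW.
  have d0 : 0 < 1 - s by rewrite subr_gt0.
  have kb : k%:R * s ^+ k <= (1 - s)^-1.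
    rewrite -[leRHS]mul1r ler_pdivlMr// (le_trans (mulrn_expr_bound _ _ (ltW s0) s1))//.
    by rewrite lerBlDr lerDl ltW.
  have kp : 0 <= k%:R * s ^+ k by rewrite mulr_ge0// ltW.
  have kb2 : (k%:R * s ^+ k) ^+ 2 <= (1 - s)^-1 ^+ 2.
    by rewrite lerXn2r// nnegrE// (le_trans kp).
  rewrite -s3 -exprM mulnC exprM.
  set e := s ^+ k in e0 e1 kb kp kb2 *; set m : R := k%:R in kb kp kb2 *.
  have m0 : 0 <= m by apply: ler0n.
  have e20 : 0 <= e ^+ 2 by rewrite exprn_ge0// ltW.
  have e30 : 0 <= e ^+ 3 by rewrite exprn_ge0// ltW.
  rewrite normrM (ger0_norm e30).
  rewrite [e ^+ 3]exprSr [leLHS]mulrA ler_wpM2r ?(ltW e0)//.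
  rewrite -[X in _ * X <= _](ger0_norm e20) -normrM.
  rewrite /C -exprVn.
  rewrite (_ : _ * e ^+ 2 = x * e ^+ 2 + y * (m * e * e) + z * (m * e) ^+ 2); last by ring.
  rewrite (le_trans (ler_normD _ _))// lerD//; last first.
    by rewrite normrM ler_wpM2l// ger0_norm ?exprn_ge0.
  rewrite (le_trans (ler_normD _ _))// lerD//.
    by rewrite normrM ler_piMr// ger0_norm ?exprn_ge0 ?exprn_ile1 ?ltW.
  have mee : 0 <= m * e * e by rewrite mulr_ge0// ltW.
  rewrite normrM ler_wpM2l// (ger0_norm mee).
  by rewrite (le_trans _ kb)// ler_piMr.
apply: norm_cvg0.
apply: (@squeeze_cvgr _ _ _ _ (fun=> 0)); last 2 first.
- exact: cvg_cst.
- exact: cg.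
by near=> k; rewrite normr_ge0 bound.
Unshelve. all: by end_near. Qed.

Definition piece q b k : set R := `[b * q ^+ k.+1, b * q ^+ k[%classic.

Lemma bigcup_pieces q b : 0 < q -> q < 1 -> 0 < b ->
  \bigcup_k piece q b k = `]0, b[%classic.
Proof.
move=> q0 q1 b0; apply/seteqP; split => x /=.
  move=> [k _]; rewrite /piece/= !in_itv/= => /andP[h1 h2]; apply/andP; split.
    by rewrite (lt_le_trans _ h1)// mulr_gt0// exprn_gt0.
  by rewrite (lt_le_trans h2)// ler_piMr ?(ltW b0)// exprn_ile1// ltW.
rewrite in_itv/= => /andP[x0 xb].
have ex : exists n, b * q ^+ n <= x.
  have cg : (fun k => b * q ^+ k) @ \oo --> (0 : R).
    by apply: cvg_geometric; rewrite ger0_norm ?ltW.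
  have /cvgrPdist_lt /(_ x x0) [N _ /(_ N (leqnn N))] := cg.
  rewrite sub0r normrN ger0_norm; last by rewrite mulr_ge0 ?exprn_ge0 ?ltW.
  by move=> /ltW h; exists N.
(* The piece index is one less than the least [n] with [b * q ^+ n <= x]; this [n] is positive
   because [x < b]. *)
case: (ex_minnP ex) => -[|m] hm min.
  by move: hm; rewrite expr0 mulr1 leNgt xb.
exists m => //; rewrite /piece/= in_itv/= hm/= ltNge; apply/negP => h.
by have := min _ h; rewrite ltnn.
Qed.

Lemma trivIset_pieces q b : 0 < q -> q < 1 -> 0 < b ->
  trivIset setT (piece q b).
Proof.
move=> q0 q1 b0.
suff H i j x : (i < j)%N -> x \in `[b * q ^+ i.+1, b * q ^+ i[ ->
    x \in `[b * q ^+ j.+1, b * q ^+ j[ -> False.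
  apply/trivIsetP => i j _ _ ij; rewrite -subset0 => x [/= hi hj].
  by move: ij; rewrite neq_ltn => /orP[ij|ij]; [apply: (H i j x)|apply: (H j i x)].
move=> ij; rewrite !in_itv/= => /andP[h1 _] /andP[_ h2].
have := le_lt_trans h1 h2; rewrite ltr_pM2l// ltNge.
by rewrite ler_wiXn2l ?ltW.
Qed.

Lemma measurable_fun_pieces d (T : measurableType d) q b (f : R -> T) :
  0 < q -> q < 1 -> 0 < b ->
  (forall k, measurable_fun (piece q b k) f) ->
  measurable_fun `]0, b[ f.
Proof.
move=> q0 q1 b0 mf; rewrite -(bigcup_pieces _ _ q0 q1 b0).
by apply/measurable_fun_bigcup => // k; exact: measurable_itv.
Qed.

(** Here [u k] is a guess for the integral over []0, b * q ^+ k[]. Checking the guess on single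
    pieces suffices, because the sum over pieces telescopes and [u] tends to 0. *)
Lemma integral_pieces q b (f : R -> \bar R) (u : nat -> R) :
  0 < q -> q < 1 -> 0 < b -> measurable_fun `]0, b[ f ->
  (forall x, `]0, b[%classic x -> (0 <= f x)%E) ->
  u @ \oo --> (0 : R) ->
  (forall k, (\int[leb]_(x in piece q b k) f x)%E = (u k - u k.+1)%:E) ->
  (\int[leb]_(x in `]0%R, b[) f x)%E = (u 0)%:E.
Proof.
move=> q0 q1 b0 mf f0 u0 uk.
have bp := bigcup_pieces _ _ q0 q1 b0.
rewrite -{1}bp ge0_integral_bigcup; last 4 first.
- by move=> k; exact: measurable_itv.
- by rewrite bp.
- by move=> x; rewrite bp; exact: f0.
- exact: trivIset_pieces.
under eq_eseriesr do rewrite uk.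
apply/cvg_lim => //.
rewrite (_ : (fun n => _) = (fun n => (u 0%N - u n)%:E)); last first.
  apply/funext => n; rewrite sumEFin; congr (_%:E).
  rewrite (telescope_big (fun i j => u i - u j)) => [|k _]; last by rewrite /= addrA subrK.
  by case: n => [|n] //=; rewrite subrr.
apply: cvg_EFin; first exact: nearW.
rewrite -[X in _ --> X]subr0; apply: cvgB => //; exact: cvg_cst.
Qed.

End Pieces.


(** * Nodes of a filtration, and the filtration refining towards 0 *)

Section Filt.
Context {R : realType}.
Local Notation leb := (@lebesgue_measure R).
Implicit Types (t : seq bool -> R) (s : seq bool).

(** [node_go] reads words from the root; this is the recursion at the other end, from a node to its
    children, as induction with [last_ind] requires. *)
Lemma node_go_rcons t pre p s b :
  node_go t pre p (rcons s b) =
  let p' := node_go t pre p s in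
  let m := p'.1 + t (pre ++ s) * (p'.2 - p'.1) in
  if b then (m, p'.2) else (p'.1, m).
Proof.
elim: s pre p => [|a s ih] pre p /=; first by rewrite cats0.
by rewrite ih cat_rcons.
Qed.

Lemma node_iv_rcons t s b :
  node_iv t (rcons s b) =
  let p := node_iv t s in
  let m := p.1 + t s * (p.2 - p.1) in
  if b then (m, p.2) else (p.1, m).
Proof. exact: node_go_rcons. Qed.

Lemma node_iv_lt t s : (forall s', 0 < t s' < 1) ->
  (node_iv t s).1 < (node_iv t s).2.
Proof.
move=> t01; elim/last_ind: s => [|s b ih]; first exact: ltr01.
rewrite node_iv_rcons /=; have /andP[h0 h1] := t01 s.
set p := node_iv t s in ih *.
have d0 : 0 < p.2 - p.1 by rewrite subr_gt0.
by case: b => /=; nra.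
Qed.

Lemma size_node n s : s \in nodes n -> size s = n.
Proof.
elim: n s => [|n ih] s /=; first by rewrite inE => /eqP ->.
move=> /flatten_mapP[s' /ih <-]; rewrite !inE => /orP[] /eqP->;
  by rewrite size_rcons.
Qed.

Lemma node_length t (r : R) s : (forall s', 0 < t s' < 1) ->
  (forall s', t s' <= r) -> (forall s', 1 - t s' <= r) ->
  (node_iv t s).2 - (node_iv t s).1 <= r ^+ size s.
Proof.
move=> t01 tr tr'; elim/last_ind: s => [|s b ih]; first by rewrite subr0.
have := node_iv_lt t s t01.
rewrite node_iv_rcons /= size_rcons exprS; have /andP[h0 h1] := t01 s.
have := tr s; have := tr' s.
set p := node_iv t s in ih *; set e := r ^+ _ in ih *.
move=> r1 r2 p12.
have r0 : 0 < r by apply: lt_le_trans r2.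
have := ler_wpM2l (ltW r0) ih.
have d0 : 0 <= p.2 - p.1 by rewrite subr_ge0 ltW.
have := ler_wpM2r d0 r1; have := ler_wpM2r d0 r2.
by case: b => /=; lra.
Qed.

Lemma is_filtration_bounded_ratio t (r : R) : r < 1 ->
  (forall s, 0 < t s < 1) -> (forall s, t s <= r) -> (forall s, 1 - t s <= r) ->
  is_filtration t.
Proof.
move=> r1 t01 tr tr'; split=> // eps e0.
have r0 : 0 < r by have /andP[+ _] := t01 [::]; move/lt_le_trans; apply.
have cg : (fun k => 1 * r ^+ k) @ \oo --> (0 : R).
  by apply: cvg_geometric; rewrite ger0_norm ?ltW.
have /cvgrPdist_lt /(_ eps e0) [N _ hN] := cg.
exists N => n Nn s /size_node sn.
apply: le_lt_trans (node_length _ _ s t01 tr tr') _; rewrite sn.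
have := hN _ Nn; rewrite /= mul1r sub0r normrN ger0_norm//.
by rewrite exprn_ge0// ltW.
Qed.

(** The induction replaces [F s] by the sum of [F] over the two children of [s], which again
    vanishes off the leftmost chain. *)
Lemma sum_nodes_nseq (F : seq bool -> R) n :
  (forall s, true \in s -> F s = 0) ->
  \sum_(s <- nodes n) F s = F (nseq n false).
Proof.
elim: n F => [|n ih] F F0; first by rewrite big_seq1.
rewrite /= big_flatten big_map /=.
under eq_bigr do rewrite big_cons big_seq1.
rewrite (ih (fun s => F (rcons s false) + F (rcons s true))).
  rewrite (F0 (rcons _ true)) ?addr0; last by rewrite mem_rcons inE eqxx.
  by congr F; elim: n {ih} => //= n ->.
by move=> s hs; rewrite !F0 ?addr0// mem_rcons inE hs orbT.
Qed.

(** Only the leftmost chain, the intervals [[0, q ^+ k)], is cut with ratio [q]. The extremal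
    function is constant on every other node, where halving serves only to make the mesh tend to
    0. *)
Definition corner_split (q : R) s : R := if true \in s then 2^-1 else q.

Lemma notin_true_nseq s : true \notin s -> s = nseq (size s) false.
Proof. by elim: s => //= -[|] s ih //=; rewrite inE /= => /ih <-. Qed.

Lemma rcons_nseq (T : Type) (x : T) n : rcons (nseq n x) x = nseq n.+1 x.
Proof. by elim: n => //= n ->. Qed.

Lemma node_iv_nseq (q : R) n : node_iv (corner_split q) (nseq n false) = (0, q ^+ n).
Proof.
elim: n => [|n ih]; first by rewrite expr0.
rewrite -rcons_nseq node_iv_rcons ih /= /corner_split mem_nseq andbF.
by rewrite add0r subr0 exprS.
Qed.

(** The first [true] in [s], at position [k], moves from [[0, q ^+ k)] to its right child, which is
    exactly piece [k]; later cuts stay inside it. *)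
Lemma node_iv_corner (q : R) s : 0 < q < 1 -> true \in s ->
  exists k, q ^+ k.+1 <= (node_iv (corner_split q) s).1 /\
            (node_iv (corner_split q) s).2 <= q ^+ k.
Proof.
move=> /andP[q0 q1].
have t01 s' : 0 < corner_split q s' < 1.
  by rewrite /corner_split; case: ifP => _; rewrite ?q0//; lra.
elim/last_ind: s => // s b ih; rewrite mem_rcons inE => hs.
have [ts|ts] := boolP (true \in s).
  have [k [h1 h2]] := ih ts; exists k; rewrite node_iv_rcons /=.
  have := node_iv_lt _ s t01; have /andP[] := t01 s.
  set p := node_iv _ s in h1 h2 *.
  by move=> a0 a1 p12; case: b hs => _ /=; split => //; nra.
move: hs; rewrite (negbTE ts) orbF => /eqP <-.
rewrite (notin_true_nseq s ts); exists (size s).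
rewrite node_iv_rcons node_iv_nseq /= /corner_split mem_nseq andbF.
by rewrite add0r subr0 exprS.
Qed.
End Filt.


(** * Integrals of powers and the classical characteristic of a power weight *)

Section PowerWeight.
Context {R : realType}.
Local Notation leb := (@lebesgue_measure R).

Lemma continuous_powR (x p : R) : 0 < x -> {for x, continuous (fun y => y `^ p)}.
Proof.
move=> x0; apply: differentiable_continuous; apply/derivable1_diffP.
by apply: derivable_powR; rewrite in_itv/= x0.
Qed.

Lemma integral_powR_gt0 (a b p : R) : 0 < a -> a < b -> p != 0 ->
  (\int[leb]_(x in `[a, b]) (x `^ (p - 1)%R)%:E)%E = ((b `^ p - a `^ p) / p)%:E.
Proof.
move=> a0 ab p0.
rewrite (@continuous_FTC2 _ _ (fun x => x `^ p / p) a b ab).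
- by rewrite -EFinB mulrBl.
- apply: continuous_in_subspaceT => x; rewrite inE/= in_itv/= => /andP[ax _].
  by apply: continuous_powR; apply: lt_le_trans ax.
- split.
  + move=> x; rewrite in_itv/= => /andP[ax _]; apply: derivableM => //.
    by apply: derivable_powR; rewrite in_itv/= (lt_trans a0).
  + apply: cvg_at_right_filter; apply: cvgMl.
    exact: continuous_powR.
  + apply: cvg_at_left_filter; apply: cvgMl.
    by apply: continuous_powR; apply: lt_trans ab.
- move=> x; rewrite in_itv/= => /andP[ax _].
  have x0 : 0 < x by apply: lt_trans ax.
  rewrite derive1Mr; last by apply: derivable_powR; rewrite in_itv/= x0.
  by rewrite powR_derive1 ?in_itv/= ?x0// mulrAC divff// mul1r.
Qed.

Lemma integral_powR (a b p : R) : 0 <= a -> a < b -> 0 < p ->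
  (\int[leb]_(x in `[a, b]) (x `^ (p - 1)%R)%:E)%E = ((b `^ p - a `^ p) / p)%:E.
Proof.
rewrite le_eqVlt => /predU1P[<-|a0] ab p0; last first.
  by apply: integral_powR_gt0 => //; rewrite gt_eqF.
have mf D : measurable_fun D (fun x : R => (x `^ (p - 1))%:E).
  apply/measurable_EFinP; apply: measurable_funTS; exact: measurable_powR.
rewrite powR0 ?gt_eqF// subr0 integral_itv_bndoo; last exact: mf.
have q0 : 0 < 2^-1 :> R by lra.
have q1 : 2^-1 < 1 :> R by lra.
(* For [a = 0] the integrand may be singular, so the integral is summed over dyadic pieces away from
   0. Here [u k] is [(b / 2 ^ k) ^ p / p], with zero coefficients added to fit
   [quadratic_geometric_cvg0]. *)
pose u k := (b `^ p / p + 0 * k%:R + 0 * k%:R ^+ 2) * (2^-1 `^ p) ^+ k.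
have qp k : b `^ p * (2^-1 `^ p) ^+ k = (b * 2^-1 ^+ k) `^ p.
  rewrite powRM ?exprn_ge0 ?ltW// -powR_mulrn ?powR_ge0//.
  by rewrite powRAC powR_mulrn// ltW.
rewrite (@integral_pieces _ 2^-1 b _ u)//.
- by rewrite /u !mul0r !addr0 expr0 mulr1.
- by move=> x _; rewrite lee_fin powR_ge0.
- apply: quadratic_geometric_cvg0; first exact: powR_gt0.
  have : 2^-1 `^ p < 1 `^ p :> R by rewrite gt0_ltr_powR// nnegrE ltW.
  by rewrite powR1.
- move=> k; rewrite /piece integral_itv_bndo_bndc; last exact: mf.
  rewrite integral_powR_gt0 ?gt_eqF//; last 2 first.
  + by rewrite mulr_gt0// exprn_gt0.
  + by rewrite ltr_pM2l// ltr_iXn2l.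
  by rewrite -!qp /u; congr EFin; field; rewrite gt_eqF.
Qed.

(* The value at [0] is immaterial for integrals; it is set to [1] because
   [0 `^ (- al) = 0] is not a legal value for a weight. *)
Definition power_weight (al x : R) : R := if x == 0 then 1 else x `^ (- al).

Lemma measurable_power_weight al D : measurable_fun D (power_weight al).
Proof.
apply: measurable_funTS; rewrite /power_weight.
apply: measurable_fun_ifT => //=.
by apply: measurable_fun_eqr; [exact: measurable_id|exact: measurable_cst].
Qed.

Lemma integral_power_weight (al a b : R) : 0 <= a -> a < b -> al < 1 ->
  (\int[leb]_(x in `[a, b]) (power_weight al x)%:E)%E =
  ((b `^ (1 - al) - a `^ (1 - al)) / (1 - al))%:E.
Proof.
move=> a0 ab al1; rewrite -integral_powR ?subr_gt0//.
apply: eq_integral_itv_bounded => //.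
- exact: measurable_power_weight.
- by apply: measurable_funTS; exact: measurable_powR.
move=> x; rewrite in_itv/= => /andP[ax _].
by rewrite /power_weight gt_eqF ?(le_lt_trans a0)// addrAC subrr add0r.
Qed.

Lemma integral_power_weightV (al a b : R) : 0 <= a -> a < b -> -1 < al ->
  (\int[leb]_(x in `[a, b]) ((power_weight al x)^-1)%:E)%E =
  ((b `^ (1 + al) - a `^ (1 + al)) / (1 + al))%:E.
Proof.
move=> a0 ab al1; rewrite -integral_powR//; last by lra.
apply: (@eq_integral_itv_bounded _ _ _ (fun x => x `^ (1 + al - 1))
                                 (fun x => (power_weight al x)^-1)) => //.
- apply: (eq_measurable_fun (fun x => x `^ al)).
    move=> x; rewrite inE/= in_itv/= => /andP[ax _].
    by rewrite /power_weight gt_eqF ?(le_lt_trans a0)// powRN invrK.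
  by apply: measurable_funTS; exact: measurable_powR.
- by apply: measurable_funTS; exact: measurable_powR.
move=> x; rewrite in_itv/= => /andP[ax _].
by rewrite /power_weight gt_eqF ?(le_lt_trans a0)// powRN invrK addrAC subrr add0r.
Qed.

Lemma A2cl_power_weight (al : R) : 0 <= al -> al < 1 ->
  A2cl (power_weight al) = ((1 - al ^+ 2)^-1)%:E.
Proof.
move=> al0 al1.
have al2 : 0 < 1 - al ^+ 2 by nra.
pose W (x : R) := (power_weight al x)^-1.
have avgE (a b : R) : 0 <= a -> a < b ->
    (eavg (power_weight al) a b * eavg W a b)%E =
    ((b `^ (1 - al) - a `^ (1 - al)) * (b `^ (1 + al) - a `^ (1 + al)) /
     (b - a) ^+ 2 / (1 - al ^+ 2))%:E.
  move=> a0 ab; rewrite /eavg.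
  rewrite (_ : civ a b = `[a, b]%classic); last by rewrite set_itvcc.
  rewrite integral_power_weight// integral_power_weightV//; last by lra.
  rewrite -!EFinM; congr EFin.
  have ? : b - a != 0 by rewrite subr_eq0 gt_eqF.
  by field; rewrite ?(gt_eqF al2)//=; lra.
apply/eqP; rewrite eq_le; apply/andP; split.
  apply: ge_ereal_sup => _ [a [b [a0 ab b1 ->]]].
  rewrite avgE// lee_fin ler_piMl ?invr_ge0 ?(ltW al2)//.
  have d0 : 0 < (b - a) ^+ 2 by rewrite exprn_gt0// subr_gt0.
  rewrite ler_pdivrMr// mul1r.
  have powE (c : R) : 0 <= c -> c `^ (1 - al) * c `^ (1 + al) = c ^+ 2.
    move=> c0; rewrite -powRD; last by apply/implyP; lra.
    by rewrite -powR_mulrn//; congr (_ `^ _); lra.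
  have b0 : 0 < b by apply: le_lt_trans ab.
  have sq (c : R) : 0 <= c -> c `^ (1 + al) = c * c `^ al.
    by move=> c0; rewrite powRD ?powRr1//; apply/implyP; lra.
  (* Expanding the product of differences gives [b ^ 2 + a ^ 2] minus two cross terms, to be
     compared with [(b - a) ^ 2]. *)
  suff : 2 * (a * b) <= b `^ (1 - al) * a `^ (1 + al) + a `^ (1 - al) * b `^ (1 + al).
    have := powE a a0; have := powE b (ltW b0); nra.
  move: a0; rewrite le_eqVlt => /predU1P[<-|a0].
    rewrite mul0r mulr0 [0 `^ (1 - al)]powR0 ?[0 `^ (1 + al)]powR0 ?mul0r ?mulr0 ?addr0//; lra.
  have sm (c : R) : 0 < c -> c `^ (1 - al) = c / c `^ al.
    by move=> c0; rewrite powRB ?powRr1 ?ltW// (gt_eqF c0) implybT.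
  rewrite !sq ?sm ?(ltW a0) ?(ltW b0)//.
  have pa : 0 < a `^ al by apply: powR_gt0.
  have pb : 0 < b `^ al by apply: powR_gt0.
  set x := a `^ al in pa *; set y := b `^ al in pb *.
  (* After dividing by [a * b], the claim is [x / y + y / x >= 2] for [x = a ^ al] and
     [y = b ^ al]. *)
  have -> : b / y * (a * x) + a / x * (b * y) = (a * b) * ((x ^+ 2 + y ^+ 2) / (x * y)).
    by field; rewrite !gt_eqF.
  rewrite [2 * _]mulrC ler_pM2l ?mulr_gt0// ler_pdivlMr ?mulr_gt0//.
  have := sqr_ge0 (x - y); lra.
(* The supremum is attained on [[0, 1]], where both power differences equal 1. *)
apply: ereal_sup_ubound; exists 0, 1; split => //.
rewrite avgE// !powR1 !powR0 ?subr0 ?expr1n ?divr1 ?mul1r//; lra.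
Qed.

End PowerWeight.


(** * The extremal function, its averages and its square function *)

Section Level.
Context {R : realType}.
Local Notation leb := (@lebesgue_measure R).
Variable q : R.
Hypotheses (q0 : 0 < q) (q1 : q < 1).

(** The index of the piece containing [x] when [0 < x < 1]. For [x <= 0] no index exists and the
    default is 0; on the unit interval this concerns only the null set [{0}]. *)
Definition level (x : R) : nat :=
  if pselect (exists n, q ^+ n.+1 <= x) is left ex then ex_minn ex else 0%N.

Lemma level_eq k x : q ^+ k.+1 <= x < q ^+ k -> level x = k.
Proof.
move=> /andP[h1 h2]; rewrite /level; case: pselect => [ex|]; last first.
  by case; exists k.
case: ex_minnP => m hm min; apply/eqP; rewrite eqn_leq min//=.
rewrite leqNgt; apply/negP => mk.
have : q ^+ k <= q ^+ m.+1 by rewrite ler_wiXn2l// ltW.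
by rewrite leNgt (le_lt_trans hm h2).
Qed.

Lemma piece_level n k x : piece q (q ^+ n) k x -> level x = (n + k)%N.
Proof.
rewrite /piece/= in_itv/= -!exprD addnS; exact: level_eq.
Qed.

Lemma measurable_comp_level (h : nat -> R) n :
  measurable_fun `[0, q ^+ n] (h \o level).
Proof.
apply: (@measurable_fun_itv_cc _ 0 (q ^+ n) false true).
apply: (@measurable_fun_pieces _ _ _ q) => //; first exact: exprn_gt0.
move=> k; apply: (eq_measurable_fun (cst (h (n + k)%N))); last exact: measurable_cst.
by move=> x; rewrite inE => /piece_level /= ->.
Qed.

Lemma integral_piece_cst (b c : R) k (f : R -> \bar R) : 0 < b ->
  (forall x, piece q b k x -> f x = c%:E) ->
  (\int[leb]_(x in piece q b k) f x)%E = (c * (b * q ^+ k - b * q ^+ k.+1))%:E.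
Proof.
move=> b0 fc; rewrite (eq_integral (cst c%:E)); last first.
  by move=> x; rewrite inE => /fc.
rewrite integral_cst; last exact: measurable_itv.
rewrite /piece /= lebesgue_measure_itv /= lte_fin ltr_pM2l// ltr_iXn2l//.
by rewrite ltnSn -EFinB -EFinM.
Qed.

Let K : R := q / (1 - q).

(** On [[0, q ^+ n)] under normalized Lebesgue measure, [level] is [n] plus a geometric variable of
    ratio [q], whose mean is [K]. The witness [u k] is the same formula with [n + k] in place of
    [n]. *)
Lemma integral_level n :
  (\int[leb]_(x in `[0%R, (q ^+ n)%R]) (level x)%:R%:E)%E =
  ((n%:R + K) * q ^+ n)%:E.
Proof.
have mf := measurable_comp_level (fun k => k%:R) n.
have mo : measurable_fun `]0, q ^+ n[ (fun x => (level x)%:R%:E : \bar R).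
  apply/measurable_EFinP; apply: measurable_funS mf; first exact: measurable_itv.
  by apply: subset_itv; rewrite bnd_simp.
have qn0 : 0 < q ^+ n by apply: exprn_gt0.
rewrite integral_itv_bndoo//.
pose u (k : nat) := ((n%:R + K) * q ^+ n + q ^+ n * k%:R + 0 * k%:R ^+ 2) * q ^+ k.
rewrite (@integral_pieces _ q (q ^+ n) _ u)//.
- by rewrite /u expr0 !mulr0 mul0r !addr0 mulr1.
- exact: quadratic_geometric_cvg0.
- move=> k; rewrite (integral_piece_cst _ (n + k)%:R)//; last first.
    by move=> x /piece_level ->.
  congr EFin; rewrite /u natrD -natr1 exprS /K; field.
  by rewrite subr_eq0 gt_eqF.
Qed.

(** Subtracting [K], the mean of [level] on the unit interval, makes the function mean zero
    there. *)
Definition corner_fun (x : R) : R := (level x)%:R - K.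

Lemma integrable_level n :
  leb.-integrable `[0, q ^+ n] (fun x => (level x)%:R%:E).
Proof.
apply/integrableP; split.
  by apply/measurable_EFinP; exact: (measurable_comp_level (fun k => k%:R)).
under eq_integral do rewrite gee0_abs ?lee_fin//.
by rewrite integral_level ltry.
Qed.

Lemma integrable_cst_itv (a b c : R) : leb.-integrable `[a, b] (cst c%:E).
Proof.
apply/integrableP; split; first exact: measurable_cst.
rewrite integral_cst//= lebesgue_measure_itv/=; case: ifP => _.
  by rewrite -EFinB -EFinM ltry.
by rewrite mule0 ltry.
Qed.

Lemma measurable_corner_fun n : measurable_fun `[0, q ^+ n] corner_fun.
Proof. exact: (measurable_comp_level (fun k => k%:R - K)). Qed.

Lemma integrable_corner_fun n : leb.-integrable `[0, q ^+ n] (EFin \o corner_fun).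
Proof.
have -> : EFin \o corner_fun = ((fun x => (level x)%:R%:E) \- cst K%:E)%E.
  by apply/funext.
by apply: integrableB; [|exact: integrable_level|exact: integrable_cst_itv].
Qed.

Lemma integral_corner_fun n :
  (\int[leb]_(x in `[0%R, (q ^+ n)%R]) (corner_fun x)%:E)%E = (n%:R * q ^+ n)%:E.
Proof.
have -> : (fun x => (corner_fun x)%:E) = ((fun x => (level x)%:R%:E) \- cst K%:E)%E.
  by [].
rewrite integralB//; [|exact: integrable_level|exact: integrable_cst_itv].
rewrite integral_level integral_cst//= lebesgue_measure_itv/= lte_fin exprn_gt0//.
by rewrite oppr0 adde0 -EFinM -EFinB; congr EFin; ring.
Qed.

Lemma avg_corner_fun n : avg corner_fun (0, q ^+ n) = n%:R.
Proof.
rewrite /avg /= subr0 (_ : iv_set _ = `[0, q ^+ n[%classic); last first.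
  by rewrite set_itvco.
rewrite /Rintegral integral_itv_bndo_bndc; last first.
  apply/emeasurable_fun_itv_bndo_bndcP/measurable_EFinP.
  exact: measurable_corner_fun.
by rewrite integral_corner_fun /= mulrC mulfK// gt_eqF// exprn_gt0.
Qed.

Lemma avg_cst (f : R -> R) (p : R * R) (c : R) : p.1 < p.2 ->
  (forall x, iv_set p x -> f x = c) -> avg f p = c.
Proof.
move=> p12 fc; rewrite /avg.
have -> : Rintegral leb (iv_set p) f = Rintegral leb (iv_set p) (cst c).
  by apply: eq_Rintegral => x; rewrite inE; exact: fc.
rewrite (_ : iv_set p = `[p.1, p.2[%classic); last by rewrite set_itvco.
rewrite Rintegral_cst//= lebesgue_measure_itv/= lte_fin p12 /=.
by rewrite mulrC mulfK// subr_eq0 gt_eqF.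
Qed.

Lemma indic_iv (p : R * R) x : \1_(iv_set p) x = (p.1 <= x < p.2)%R%:R :> R.
Proof.
rewrite indicE; congr (_ %:R); congr nat_of_bool.
by apply/idP/idP; rewrite inE.
Qed.

Let t := corner_split q.

Lemma corner_split01 s : 0 < t s < 1.
Proof. by rewrite /t /corner_split; case: ifP => _; rewrite ?q0 ?q1//; lra. Qed.

Lemma avg_corner_fun_piece s k :
  q ^+ k.+1 <= (node_iv t s).1 -> (node_iv t s).2 <= q ^+ k ->
  avg corner_fun (node_iv t s) = k%:R - K.
Proof.
move=> h1 h2; apply: avg_cst; first exact: node_iv_lt corner_split01.
move=> x; rewrite /iv_set/= => /andP[x1 x2].
by rewrite /corner_fun (level_eq k)// (le_trans h1 x1) (lt_le_trans x2 h2).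
Qed.

(** Such a node lies within one piece, where [corner_fun] is constant: the three averages coincide
    and the indicators of the children add up to that of the parent. *)
Lemma Delta_corner_fun_true s x : true \in s -> Delta t corner_fun s x = 0.
Proof.
move=> ts; have [k [h1 h2]] := node_iv_corner _ _ (introT andP (conj q0 q1)) ts.
have p12 := node_iv_lt t s corner_split01.
have /andP[t0 t1] := corner_split01 s.
rewrite /Delta (avg_corner_fun_piece s k)//.
rewrite !(avg_corner_fun_piece _ k); try by rewrite node_iv_rcons /= -/t; nra.
rewrite !indic_iv !node_iv_rcons /= -/t.
move: (node_iv t s) p12 {h1 h2} => p p12.
set m := p.1 + _.
have m1 : p.1 < m by rewrite /m; nra.
have m2 : m < p.2 by rewrite /m; nra.
have [xm|xm] := ltP x m.
  by rewrite (lt_trans xm m2) /= !andbT mulr0 addr0 subrr.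
by rewrite andbF (le_trans (ltW m1) xm) /= mulr0 add0r subrr.
Qed.

(** Cutting [[0, q ^+ n)] raises the average from [n] to [n + 1] on the left child. On the right
    child, piece [n], it drops from [n] to [n - K]. *)
Lemma Delta_corner_fun_nseq n k x : q ^+ k.+1 <= x < q ^+ k ->
  Delta t corner_fun (nseq n false) x =
  if (n < k)%N then 1 else if n == k then - K else 0.
Proof.
move=> /andP[x1 x2].
have qn m : q ^+ m.+1 < q ^+ m by rewrite ltr_iXn2l.
have qle i j : (i <= j)%N -> q ^+ j <= q ^+ i by move=> ij; rewrite ler_wiXn2l// ltW.
have x0 : 0 <= x by apply: le_trans x1; rewrite exprn_ge0// ltW.
have right_iv : node_iv t (rcons (nseq n false) true) = (q ^+ n.+1, q ^+ n).
  rewrite node_iv_rcons node_iv_nseq /= /t /corner_split mem_nseq andbF.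
  by rewrite add0r subr0 exprS.
rewrite /Delta (avg_corner_fun_piece (rcons _ true) n) ?right_iv//.
rewrite rcons_nseq !node_iv_nseq !avg_corner_fun !indic_iv /= x0 /=.
rewrite -natr1.
case: ltngtP => [nk|kn|->].
- have xn : x < q ^+ n.+1 by apply: lt_le_trans x2 (qle _ _ nk).
  by rewrite xn (lt_trans xn (qn n)) leNgt xn /=; ring.
- have xn : q ^+ n <= x by apply: le_trans x1; exact: qle.
  by rewrite !ltNge xn (le_trans (ltW (qn n)) xn) /=; ring.
- by rewrite x2 x1 ltNge x1 /=; ring.
Qed.

Lemma Ssq_corner_fun k x : q ^+ k.+1 <= x < q ^+ k ->
  Ssq t corner_fun x = (k%:R + K ^+ 2)%:E.
Proof.
move=> hx; rewrite /Ssq.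
under eq_eseriesr => n _.
  rewrite sum_nodes_nseq; last first.
    by move=> s ts; rewrite Delta_corner_fun_true// expr0n.
  rewrite (Delta_corner_fun_nseq n k)//.
  over.
(* On piece [k] the terms below [k] contribute 1 each, the term [k] contributes [K ^+ 2], and later
   nodes no longer contain [x]. *)
rewrite (nneseries_split 0 k.+1) => [|n _]; last by rewrite lee_fin sqr_ge0.
rewrite [X in (_ + X)%E]eseries0 => [|n kn _]; last first.
  by rewrite add0n in kn; rewrite ltnNge (ltnW kn) /= gtn_eqF// expr0n.
rewrite adde0 add0n big_nat_recr//= ltnn eqxx.
rewrite (eq_big_nat _ _ (F2 := fun=> 1%:E)); last first.
  by move=> n /andP[_ ->]; rewrite expr1n.
by rewrite sumEFin sumr_const_nat subn0 sqrrN.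
Qed.

(** * Weighted norms of the extremal function and of its square function *)

Variable al : R.
Hypothesis (al1 : al < 1).
Let de := 1 - al.
Let rho := q `^ de.

Lemma rho01 : 0 < rho < 1.
Proof.
rewrite powR_gt0//=; have : q `^ de < 1 `^ de.
  by rewrite gt0_ltr_powR ?subr_gt0// nnegrE ltW.
by rewrite powR1.
Qed.

(* The [w]-mass of piece [k] is [rho ^ k * (1 - rho) / de]; the last hypothesis
   makes [h k] times it a telescoping difference. *)
Lemma L2w_sq_pieces (g : R -> \bar R) (h : nat -> R) (x y z : R) :
  (forall k r, q ^+ k.+1 <= r < q ^+ k -> g r = (h k)%:E) ->
  (forall k, 0 <= h k) ->
  (forall k, h k * (1 - rho) / de = (x + y * k%:R + z * k%:R ^+ 2)
                   - (x + y * k.+1%:R + z * k.+1%:R ^+ 2) * rho) ->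
  L2w_sq (power_weight al) g = x%:E.
Proof.
move=> gh h0 hu; rewrite /L2w_sq.
have /andP[rho0 rho1] := rho01.
have w0 r : 0 <= r -> 0 <= power_weight al r.
  by move=> r0; rewrite /power_weight; case: ifP => // _; rewrite powR_ge0.
rewrite (_ : @unit_iv R = `[0, 1]%classic); last by rewrite set_itvcc.
have gE k r : piece q 1 k r -> g r = (h k)%:E.
  by rewrite /piece/= in_itv/= !mul1r; exact: gh.
have mg : measurable_fun (`]0, 1[%classic : set R) (fun r => (g r * (power_weight al r)%:E)%E).
  apply: (@measurable_fun_pieces _ _ _ q) => // k.
  apply: (eq_measurable_fun (fun r => (h k * power_weight al r)%:E)).
    by move=> r; rewrite inE => /gE ->; rewrite EFinM.
  apply/measurable_EFinP; apply: measurable_funM; first exact: measurable_cst.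
  exact: measurable_power_weight.
rewrite integral_itv_bndoo//.
(* The candidate for the weighted integral of [g] over []0, q ^+ k[]; its increments match by the
   last hypothesis. *)
pose u (k : nat) := (x + y * k%:R + z * k%:R ^+ 2) * rho ^+ k.
rewrite (@integral_pieces _ q 1 _ u)//.
- by rewrite /u expr0 mulr1 mulr0 expr0n mulr0 !addr0.
- rewrite -(bigcup_pieces q 1)// => r [k _ kr].
  rewrite (gE _ _ kr) mule_ge0 ?lee_fin ?w0//.
  move: kr; rewrite /piece/= in_itv/= => /andP[+ _]; apply: le_trans.
  by rewrite mul1r exprn_ge0// ltW.
- exact: quadratic_geometric_cvg0.
- move=> k; have kp m : 0 < q ^+ m by apply: exprn_gt0.
  under eq_integral => r; first by rewrite inE => /gE ->; over.
  rewrite ge0_integralZl_EFin//.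
  + rewrite /piece !mul1r integral_itv_bndo_bndc; last first.
      by apply/measurable_EFinP; exact: measurable_power_weight.
    rewrite integral_power_weight//; last 2 first.
    * exact: ltW.
    * by rewrite ltr_iXn2l.
    rewrite -EFinM; congr EFin; rewrite -/de.
    have qr m : (q ^+ m) `^ de = rho ^+ m.
      by rewrite -powR_mulrn ?(ltW q0)// powRAC powR_mulrn// powR_ge0.
    rewrite !qr /u [rho ^+ k.+1]exprS.
    transitivity (rho ^+ k * (h k * (1 - rho) / de)); first by ring.
    by rewrite hu; ring.
  + exact: measurable_itv.
  + move=> r; rewrite /piece/= in_itv/= => /andP[+ _] => r0.
    by rewrite lee_fin w0// (le_trans _ r0)// mul1r ltW.
  + by apply/measurable_EFinP; exact: measurable_power_weight.
Qed.

Let M := rho / (1 - rho).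

(* The quadratic witnesses given to [L2w_sq_pieces] are [E (h (k + X))] for [X]
   geometric of ratio [rho], where [E X = M] and [E X ^ 2 = M + 2 * M ^ 2]. *)
Lemma L2w_sq_Ssq_corner_fun :
  L2w_sq (power_weight al) (Ssq t corner_fun) = ((M + K ^+ 2) / de)%:E.
Proof.
have /andP[rho0 rho1] := rho01.
apply: (L2w_sq_pieces _ (fun k => k%:R + K ^+ 2) _ de^-1 0).
- by move=> k r; exact: Ssq_corner_fun.
- by move=> k; rewrite addr_ge0// sqr_ge0.
- move=> k; rewrite -natr1 /M; field.
  by rewrite /de !subr_eq0 !gt_eqF.
Qed.

Lemma L2w_sq_corner_fun :
  L2w_sq (power_weight al) (fun r => (corner_fun r ^+ 2)%:E) =
  ((K ^+ 2 - 2 * K * M + M + 2 * M ^+ 2) / de)%:E.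
Proof.
have /andP[rho0 rho1] := rho01.
apply: (L2w_sq_pieces _ (fun k => (k%:R - K) ^+ 2) _ ((2 * M - 2 * K) / de) de^-1).
- by move=> k r /level_eq rk; rewrite /corner_fun rk.
- by move=> k; rewrite sqr_ge0.
- move=> k; rewrite -natr1 /M; field.
  by rewrite /de !subr_eq0 !gt_eqF.
Qed.

End Level.


(** * Choice of the parameters and the final estimate *)

(** Both bounds come from [q ^ p = exp (p * ln q)], using [1 + v <= exp v] together with
    [ln y <= y - 1] at [y = q] and at [y = 1 / q]. They compare the weighted mean [M] of the level
    with [K / p]. *)
Lemma power_ratio_bounds {R : realType} (q p : R) : 0 < q -> q < 1 -> 0 < p ->
  q / (1 - q) / p - 1 <= q `^ p / (1 - q `^ p) <= ((1 - q) * p)^-1.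
Proof.
move=> q0 q1 p0; have rho0 : 0 < q `^ p by apply: powR_gt0.
have lnle (y : R) : 0 < y -> ln y <= y - 1.
  by move=> y0; have := @le_ln1Dx R (y - 1); rewrite [1 + _]addrC subrK; apply; lra.
have lnq := lnle q q0.
have lnqV := lnle q^-1 (etrans (invr_gt0 q) q0); rewrite lnV// in lnqV.
have lb : 1 + p * ln q <= q `^ p by rewrite /powR gt_eqF// expR_ge1Dx.
have ub : 1 - p * ln q <= (q `^ p)^-1.
  by rewrite /powR gt_eqF// -expRN (le_trans _ (expR_ge1Dx _)).
set rho := q `^ p in rho0 lb ub *.
have rhoV : rho * rho^-1 = 1 by rewrite divff// gt_eqF.
have b1 : 1 + (1 - q) * p <= rho^-1 by nra.
have y0 : 0 < (1 - q) * p by rewrite mulr_gt0// subr_gt0.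
have b2 : rho * (1 + (1 - q) * p) <= 1.
  by have := ler_wpM2l (ltW rho0) b1; rewrite rhoV.
have rho1 : 0 < 1 - rho by nra.
have qV : q * q^-1 = 1 by rewrite divff// gt_eqF.
have b3 : (1 - rho) * q <= (1 - q) * p.
  have h : 1 - rho <= p * (q^-1 - 1) by nra.
  have := ler_wpM2r (ltW q0) h.
  by rewrite (_ : p * (q^-1 - 1) * q = (1 - q) * p)//; field; rewrite gt_eqF.
apply/andP; split.
  rewrite lerBlDr (_ : rho / (1 - rho) + 1 = (1 - rho)^-1); last first.
    by field; rewrite gt_eqF.
  rewrite -mulrA -invfM ler_pdivrMr// mulrC ler_pdivlMr//.
  by rewrite mulrC.
by rewrite ler_pdivrMr// mulrC ler_pdivlMr//; lra.
Qed.

(** The inequality is stated between squared norms. A constant has zero square function, so the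
    clauses on zero mean and positive norm exclude such trivial witnesses. *)
Theorem theorem3p2 (R : realType) :
  exists c : R, 0 < c /\
  forall A : R, 1 <= A ->
  exists (w : R -> R) (t : seq bool -> R) (f : R -> R),
    is_weight w /\ A2cl w = A%:E /\ is_filtration t /\
    measurable_fun (@unit_iv R) f /\
    (@lebesgue_measure R).-integrable (@unit_iv R) (EFin \o f) /\
    (L2w_sq w (fun x => ((f x) ^+ 2)%:E) < +oo)%E /\
    (\int[@lebesgue_measure R]_(x in @unit_iv R) (f x)%:E = 0)%E /\
    (0 < L2w_sq w (fun x => ((f x) ^+ 2)%:E))%E /\
    (((c * A) ^+ 2)%:E * L2w_sq w (Ssq t f)
       <= L2w_sq w (fun x => ((f x) ^+ 2)%:E))%E.
Proof.
exists 4^-1; split; first by lra.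
move=> A A1; have A0 : 0 < A by lra.
have AV : A * A^-1 = 1 by rewrite divff// gt_eqF.
have AV0 : 0 < A^-1 by rewrite invr_gt0.
pose al := Num.sqrt (1 - A^-1).
have al2 : al ^+ 2 = 1 - A^-1 by rewrite sqr_sqrtr//; nra.
have al0 : 0 <= al by rewrite sqrtr_ge0.
have al1 : al < 1.
  rewrite ltNge; apply/negP => h; have h2 : 1 <= al ^+ 2 by nra.
  by lra.
(* This makes [1 - q] proportional to [de], so that [K = 4 * q / de] and [M], of order [K / de], is
   at most of order [K ^+ 2]. *)
pose q := 1 - (1 - al) / 4.
have q0 : 0 < q by rewrite /q; lra.
have q1 : q < 1 by rewrite /q; lra.
have unitE : @unit_iv R = `[0, q ^+ 0]%classic by rewrite set_itvcc.
exists (power_weight al), (corner_split q), (corner_fun q).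
have /andP[Mlb Mub] := power_ratio_bounds q (1 - al) q0 q1 (etrans (subr_gt0 _ _) al1).
rewrite L2w_sq_Ssq_corner_fun// L2w_sq_corner_fun//.
have KE : q / (1 - q) = 4 * q / (1 - al).
  by rewrite {2}/q subKr invf_div mulrA [q * 4]mulrC.
set K := q / (1 - q) in KE Mlb *.
set M := q `^ (1 - al) / _ in Mlb Mub *.
have de0 : 0 < 1 - al by lra.
set de := 1 - al in de0 KE Mlb Mub *.
have de1 : de <= 1 by rewrite /de; lra.
have qE : q = 1 - de / 4 by [].
have K3 : 3 <= K by rewrite KE ler_pdivlMr// qE; lra.
(* From [A * de * (1 + al) = 1] follows [A <= 1 / de]. The lower bound [M >= K / de - 1] loses at
   most half, since [K / de >= K >= 3]. *)
have AK : A * K <= 2 * M.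
  have h : A * K <= K / de.
    rewrite mulrC ler_wpM2l//; first by lra.
    rewrite -[leLHS]mulr1 -[leRHS]mul1r ler_pdivlMr// mulr1.
    have Aal : A * al ^+ 2 = A - 1 by rewrite al2 mulrBr mulr1 AV.
    have Ade : A * (de * (1 + al)) = 1 by rewrite /de; lra.
    have : 0 <= (A * de) * al by rewrite !mulr_ge0// ltW.
    lra.
  have h2 : K <= K / de by rewrite ler_pdivlMr//; nra.
  lra.
(* The upper bound on [M] is [4 / de ^+ 2], while [K ^+ 2 = 16 * q ^+ 2 / de ^+ 2] with
   [q >= 3 / 4]. *)
have MK : M <= K ^+ 2.
  apply: le_trans Mub _; rewrite KE.
  rewrite (_ : ((1 - q) * de)^-1 = 4 / de ^+ 2); last first.
    by rewrite /q -/de; field; rewrite gt_eqF.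
  rewrite expr_div_n ler_pM2r ?invr_gt0 ?exprn_gt0//.
  by rewrite qE; nra.
have M0 : 0 < M by nra.
(* The right side equals [(K - M) ^+ 2 + M ^+ 2 + M]. *)
have f2 : M ^+ 2 <= K ^+ 2 - 2 * K * M + M + 2 * M ^+ 2.
  by have := sqr_ge0 (K - M); lra.
split; [|split; [|split; [|split; [|split; [|split; [|split; [|split]]]]]]].
- split; [|split].
  + move=> x /andP[x0 _]; rewrite /power_weight; case: ifPn => // xn0.
    by rewrite powR_gt0// lt_neqAle eq_sym xn0.
  + exact: measurable_power_weight.
  + rewrite unitE; apply/integrableP; split.
      by apply/measurable_EFinP; exact: measurable_power_weight.
    under eq_integral => x.
      rewrite inE/= in_itv/= => /andP[x0 _].
      rewrite ger0_norm; last first.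
        by rewrite /power_weight; case: ifP => // _; rewrite powR_ge0.
      over.
    by rewrite expr0 integral_power_weight// ltry.
- by rewrite A2cl_power_weight// al2 opprB addrCA subrr addr0 invrK.
- apply: (is_filtration_bounded_ratio _ q) => // [s|s|s].
  + exact: corner_split01.
  + by rewrite /corner_split; case: ifP => // _; rewrite /q; lra.
  + by rewrite /corner_split; case: ifP => // _; rewrite /q; lra.
- by rewrite unitE; exact: measurable_corner_fun.
- by rewrite unitE; exact: integrable_corner_fun.
- exact: ltry.
- by rewrite unitE integral_corner_fun// mul0r.
- by rewrite lte_fin divr_gt0//; nra.
- rewrite -EFinM lee_fin mulrA ler_pM2r ?invr_gt0//.
  (* With the constant 1/4, the left side is at most [(A * K) ^+ 2 / 8], hence at most
     [M ^+ 2 / 2]. *)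
  apply: le_trans f2.
  have h1 : (4^-1 * A) ^+ 2 * (M + K ^+ 2) <= (4^-1 * A) ^+ 2 * (2 * K ^+ 2).
    by rewrite ler_wpM2l ?sqr_ge0//; lra.
  have h2 : (A * K) ^+ 2 <= (2 * M) ^+ 2.
    by rewrite lerXn2r// nnegrE; nra.
  apply: le_trans h1 _; have := sqr_ge0 M; lra.
Qed.
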